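(* Let $f:\mathbb{C}\to\mathbb{R}$ be a continuous function with $f(z)>0$ for all $z\in\mathbb{C}$, such that for every $z\in\mathbb{C}$ $$f(z)=\frac{1}{2\pi}\int_0^{2\pi} f(z+e^{it})\,dt.$$ Then $f$ is constant.
   Context: The plane $\mathbb{R}^2$ is identified with $\mathbb{C}$. The hypothesis says that the average of $f$ (with respect to arc length) over every circle of radius $1$ equals the value of $f$ at the center of that circle; only circles of radius exactly $1$ are considered. No upper bound on $f$ is assumed. *)

(* Defs.v *)
From Stdlib Require Import Reals.
From Coquelicot Require Import Coquelicot.

(* e^{it}; Coquelicot has no complex exponential, so it is written with Euler's formula
   in Coquelicot's C, which is R * R with its product topology. *)
Definition expi (t : R) : C := (cos t, sin t).

(* Main.v *)
Require Import Defs.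
From Stdlib Require Import Reals Lra Classical IndefiniteDescription.
From Coquelicot Require Import Coquelicot.
Open Scope R_scope.

(* Energy argument for the (recurrent) random walk with unit steps e = e^{it}.
   For a compactly supported cutoff eta, the mean value property, translation
   invariance and the symmetry e -> -e give

     int int (eta(p) f(p+e) - eta(p+e) f(p))^2 / (f(p) f(p+e)) dp dt
       = int int (eta(p) - eta(p+e))^2 dp dt.

   In dimension two the right-hand side can be made arbitrarily small with eta = 1
   on any given compact set, by a logarithmic cutoff.  The left-hand side then
   forces f(p+e) = f(p) for every unit vector e, and two unit steps realise any
   small translation. *)

(** * Continuity of arithmetic combinations on a uniform space *)

Section RealContinuity.
Context {U : UniformSpace}.
Implicit Types (f g : U -> R) (x : U).

Lemma continuous_Rplus f g x :
  continuous f x -> continuous g x -> continuous (fun y => f y + g y) x.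
Proof. exact (continuous_plus (V := R_NormedModule) f g x). Qed.

Lemma continuous_Rminus f g x :
  continuous f x -> continuous g x -> continuous (fun y => f y - g y) x.
Proof. exact (continuous_minus (V := R_NormedModule) f g x). Qed.

Lemma continuous_Rmult f g x :
  continuous f x -> continuous g x -> continuous (fun y => f y * g y) x.
Proof. exact (continuous_mult (K := R_AbsRing) f g x). Qed.

Lemma continuous_Rdiv f g x :
  continuous f x -> continuous g x -> g x <> 0 ->
  continuous (fun y => f y / g y) x.
Proof.
  intros Hf Hg H. apply continuous_Rmult; [exact Hf|].
  apply (continuous_comp g Rinv); [exact Hg|now apply continuous_Rinv].
Qed.

Lemma continuous_abs f x :
  continuous f x -> continuous (fun y => Rabs (f y)) x.
Proof. intros Hf. apply (continuous_comp f Rabs); [exact Hf|apply continuous_Rabs]. Qed.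

Lemma continuous_pair {V W : UniformSpace} (f : U -> V) (g : U -> W) x :
  continuous f x -> continuous g x ->
  continuous (fun y => (f y, g y) : prod_UniformSpace V W) x.
Proof.
  intros Hf Hg. apply filterlim_locally. intros eps.
  apply (filter_imp (fun y => ball (f x) eps (f y) /\ ball (g x) eps (g y))).
  { now intros y [H1 H2]; split. }
  apply filter_and; revert eps; apply filterlim_locally; assumption.
Qed.

End RealContinuity.

(** * Integrals depending on a parameter, and Fubini for continuous integrands *)

Lemma ex_RInt_cont (f : R -> R) a b : (forall t, continuous f t) -> ex_RInt f a b.
Proof. intros H. apply (ex_RInt_continuous (V := R_CompleteNormedModule)). auto. Qed.

Lemma continuous_section_l {U V : UniformSpace} (g : U * V -> R) (u : U) (t : V) :
  continuous g (u, t) -> continuous (fun s => g (u, s)) t.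
Proof.
  intros H. apply (continuous_comp (fun s => (u, s) : prod_UniformSpace U V) g); [|exact H].
  apply continuous_pair; [apply continuous_const|apply continuous_id].
Qed.

Lemma continuous_section_r {U V : UniformSpace} (g : U * V -> R) (u : U) (t : V) :
  continuous g (u, t) -> continuous (fun v => g (v, t)) u.
Proof.
  intros H. apply (continuous_comp (fun v => (v, t) : prod_UniformSpace U V) g); [|exact H].
  apply continuous_pair; [apply continuous_id|apply continuous_const].
Qed.

(** Tube lemma: joint continuity gives a radius at each point of {u} x [a, b], and compactness of
    [a, b] makes it uniform in t. It supplies the uniform closeness needed to pass limits under an
    integral. *)
Lemma tube {U : UniformSpace} (g : U * R -> R) (a b : R) (u : U) (e : posreal) :
  (forall z, continuous g z) ->
  exists d : posreal, forall v, ball u d v ->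
    forall t, a <= t <= b -> Rabs (g (v, t) - g (u, t)) < e.
Proof.
  intros Hg.
  assert (H : forall t, exists d : posreal, forall z,
            ball ((u, t) : prod_UniformSpace U R_UniformSpace) d z ->
            Rabs (g z - g (u, t)) < e / 2).
  { intros t. pose proof (Hg (u, t)) as H.
    exact (proj1 (filterlim_locally _ _) H (pos_div_2 e)). }
  destruct (functional_choice _ H) as [delta Hd]; clear H.
  (* The covering center near t is provided only under a double negation, hence the argument by
     contradiction. *)
  destruct (compactness_value_1d a b delta) as [d Hc].
  exists d. intros v Hv t Ht. apply NNPP; intros Hn. apply (Hc t Ht).
  intros [s [Hs [H1 H2]]]. apply Hn.
  assert (Hts : ball s (delta s) t) by exact H1.
  assert (A1 := Hd s (v, t) (conj (ball_le _ _ _ H2 _ Hv) Hts)).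
  assert (A2 := Hd s (u, t) (conj (ball_center _ _) Hts)).
  replace (g (v, t) - g (u, t)) with
    ((g (v, t) - g (u, s)) - (g (u, t) - g (u, s))) by ring.
  apply Rle_lt_trans with (1 := Rabs_triang _ _). rewrite Rabs_Ropp.
  apply Rlt_le_trans with (1 := Rplus_lt_compat _ _ _ _ A1 A2). lra.
Qed.

Lemma continuous_RInt_param {U : UniformSpace} (g : U * R -> R) (a b : R) (u : U) :
  (forall z, continuous g z) ->
  continuous (fun v => RInt (fun t => g (v, t)) a b) u.
Proof.
  intros Hg.
  assert (Hc : forall v t, continuous (fun s => g (v, s)) t).
  { intros v t; apply (continuous_section_l (V := R_UniformSpace)), Hg. }
  assert (Hle : forall a b, a <= b ->
            continuous (fun v => RInt (fun t => g (v, t)) a b) u).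
  { clear a b. intros a b Hab. apply filterlim_locally. intros eps.
    (* The extra 1 keeps the denominator positive when a = b and makes the final inequality
       strict. *)
    assert (He : 0 < eps / (b - a + 1)).
    { apply Rdiv_lt_0_compat; [apply cond_pos|lra]. }
    destruct (tube g a b u (mkposreal _ He) Hg) as [d Hd]. exists d. intros v Hv.
    change (Rabs (RInt (fun t => g (v, t)) a b - RInt (fun t => g (u, t)) a b) < eps).
    rewrite <- (RInt_minus (V := R_CompleteNormedModule)) by (apply ex_RInt_cont; intros; apply Hc).
    apply Rle_lt_trans with ((b - a) * (eps / (b - a + 1))).
    - apply abs_RInt_le_const; [exact Hab| |].
      + apply ex_RInt_cont. intros t. now apply continuous_Rminus.
      + intros t Ht. left. exact (Hd v Hv t Ht).
    - assert (E : eps / (b - a + 1) * (b - a + 1) = eps) by (field; lra).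
      simpl in *. nra. }
  destruct (Rle_lt_dec a b) as [Hab|Hab]; [now apply Hle|].
  apply (continuous_ext (fun v => 0 - RInt (fun t => g (v, t)) b a)).
  - intros v. rewrite <- (opp_RInt_swap (V := R_CompleteNormedModule)) by (apply ex_RInt_cont; intros; apply Hc).
    unfold opp; simpl; ring.
  - apply continuous_Rminus; [apply continuous_const|apply Hle; lra].
Qed.

(** Both sides, seen as functions of the upper limit s of the x-integral, vanish at s = a and have
    the same derivative, the integral of g(s, t) over t. Hence their difference [h] is constantly
    zero. *)
Lemma RInt_Fubini (g : R * R -> R) (a b c d : R) :
  (forall z, continuous g z) ->
  RInt (fun x => RInt (fun t => g (x, t)) c d) a b =
  RInt (fun t => RInt (fun x => g (x, t)) a b) c d.
Proof.
  intros Hg.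
  assert (Hl : forall x t, continuous (fun s => g (x, s)) t).
  { intros; apply (continuous_section_l (U := R_UniformSpace) (V := R_UniformSpace)), Hg. }
  assert (Hr : forall x t, continuous (fun s => g (s, t)) x).
  { intros; apply (continuous_section_r (U := R_UniformSpace) (V := R_UniformSpace)), Hg. }
  assert (Hswap : forall z, continuous (fun z : R * R => g (snd z, fst z)) z).
  { intros z. apply (continuous_comp (fun z : R * R => (snd z, fst z)) g); [|apply Hg].
    destruct z. apply continuous_pair; [apply continuous_snd|apply continuous_fst]. }
  assert (Hin : forall x, continuous (fun x => RInt (fun t => g (x, t)) c d) x).
  { intros x; apply (continuous_RInt_param (U := R_UniformSpace)), Hg. }
  assert (Hin' : forall s t, continuous (fun t => RInt (fun x => g (x, t)) a s) t).
  { intros s t.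
    apply (continuous_RInt_param (U := R_UniformSpace) (fun z => g (snd z, fst z))), Hswap. }
  set (h := fun s => RInt (fun x => RInt (fun t => g (x, t)) c d) a s -
                     RInt (fun t => RInt (fun x => g (x, t)) a s) c d).
  assert (Hd1 : forall s t, is_derive (fun s => RInt (fun x => g (x, t)) a s) s (g (s, t))).
  { intros s t. apply (is_derive_RInt (V := R_NormedModule) (fun x => g (x, t)) _ a s); [|apply Hr].
    apply filter_forall. intros y. apply (RInt_correct (V := R_CompleteNormedModule)).
    apply ex_RInt_cont; intros; apply Hr. }
  assert (Hder : forall s, is_derive h s 0).
  { intros s.
    replace 0 with (minus (RInt (fun t => g (s, t)) c d) (RInt (fun t => g (s, t)) c d))
      by (unfold minus, plus, opp; simpl; ring).
    apply (is_derive_minus (V := R_NormedModule)).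
    - apply (is_derive_RInt (V := R_NormedModule)
               (fun x => RInt (fun t => g (x, t)) c d) _ a s); [|apply Hin].
      apply filter_forall. intros y. apply (RInt_correct (V := R_CompleteNormedModule)).
      apply ex_RInt_cont; intros; apply Hin.
    (* Differentiation under the integral sign: g(s, t) is rewritten as the s-derivative of the
       inner integral, the form in which the rule for parameter integrals states its result. *)
    - rewrite (RInt_ext (fun t => g (s, t))
                 (fun t => Derive (fun u => RInt (fun x => g (x, t)) a u) s)).
      + apply (is_derive_RInt_param (fun u t => RInt (fun x => g (x, t)) a u)).
        * apply filter_forall. intros y t _. eexists; apply Hd1.
        * intros t _.
          apply continuity_2d_pt_ext with (fun u v => g (u, v)).
          { intros u v. symmetry. apply is_derive_unique, Hd1. }
          apply continuity_2d_pt_filterlim.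
          apply (filterlim_ext g); [now intros []|apply Hg].
        * apply filter_forall. intros y. apply ex_RInt_cont. apply Hin'.
      + intros t _. symmetry. apply is_derive_unique, Hd1. }
  assert (Ha : h a = 0).
  { unfold h. rewrite RInt_point. rewrite (RInt_ext _ (fun _ => 0)).
    - rewrite RInt_const. unfold zero, scal; simpl. unfold mult; simpl; ring.
    - intros t _. apply (RInt_point (V := R_CompleteNormedModule)). }
  assert (Hb : h b = 0).
  { rewrite <- Ha. destruct (Rtotal_order a b) as [L|[->|L]]; [|reflexivity|].
    - symmetry. now apply (eq_is_derive (V := R_NormedModule)).
    - now apply (eq_is_derive (V := R_NormedModule)). }
  unfold h in Hb; lra.
Qed.

(** * One-dimensional integrals of continuous functions *)

Lemma RInt_nonneg (g : R -> R) a b :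
  a <= b -> (forall t, continuous g t) -> (forall t, 0 <= g t) -> 0 <= RInt g a b.
Proof. intros H Hg Hp. apply RInt_ge_0; [exact H|now apply ex_RInt_cont|auto]. Qed.

Lemma RInt_mono (g h : R -> R) a b :
  a <= b -> (forall t, continuous g t) -> (forall t, continuous h t) ->
  (forall t, g t <= h t) -> RInt g a b <= RInt h a b.
Proof. intros H Hg Hh Hp. apply RInt_le; auto; now apply ex_RInt_cont. Qed.

Lemma RInt_Rplus (g h : R -> R) a b :
  (forall t, continuous g t) -> (forall t, continuous h t) ->
  RInt (fun t => g t + h t) a b = RInt g a b + RInt h a b.
Proof.
  intros Hg Hh. apply (RInt_plus (V := R_CompleteNormedModule)); now apply ex_RInt_cont.
Qed.

Lemma RInt_Rminus (g h : R -> R) a b :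
  (forall t, continuous g t) -> (forall t, continuous h t) ->
  RInt (fun t => g t - h t) a b = RInt g a b - RInt h a b.
Proof.
  intros Hg Hh. apply (RInt_minus (V := R_CompleteNormedModule)); now apply ex_RInt_cont.
Qed.

Lemma RInt_Rscal (k : R) (g : R -> R) a b :
  (forall t, continuous g t) -> RInt (fun t => k * g t) a b = k * RInt g a b.
Proof.
  intros Hg. apply (RInt_scal (V := R_CompleteNormedModule)); now apply ex_RInt_cont.
Qed.

Lemma RInt_cst (k a b : R) : RInt (fun _ => k) a b = (b - a) * k.
Proof. exact (RInt_const (V := R_CompleteNormedModule) a b k). Qed.

Lemma RInt_split (g : R -> R) a b c :
  (forall t, continuous g t) -> RInt g a c = RInt g a b + RInt g b c.
Proof.
  intros Hg. symmetry.
  apply (RInt_Chasles (V := R_CompleteNormedModule)); now apply ex_RInt_cont.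
Qed.

Lemma RInt_eq (g h : R -> R) a b : (forall t, g t = h t) -> RInt g a b = RInt h a b.
Proof. intros H. apply (RInt_ext (V := R_CompleteNormedModule)). auto. Qed.

Lemma RInt_translate (g : R -> R) s a b :
  (forall t, continuous g t) ->
  RInt (fun t => g (t + s)) a b = RInt g (a + s) (b + s).
Proof.
  intros Hg.
  pose proof (RInt_comp_lin (V := R_CompleteNormedModule) g 1 s a b) as H.
  rewrite !Rmult_1_l in H. rewrite <- H by (apply ex_RInt_cont; exact Hg).
  apply RInt_eq. intros t. unfold scal; simpl; unfold mult; simpl.
  now rewrite !Rmult_1_l.
Qed.

Lemma RInt_ge_sub (g : R -> R) a b a' b' m :
  a <= a' -> a' <= b' -> b' <= b ->
  (forall t, continuous g t) -> (forall t, 0 <= g t) ->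
  (forall t, a' <= t <= b' -> m <= g t) -> (b' - a') * m <= RInt g a b.
Proof.
  intros H1 H2 H3 Hg Hp Hm.
  rewrite (RInt_split g a a' b), (RInt_split g a' b' b) by exact Hg.
  pose proof (RInt_nonneg g a a' H1 Hg Hp).
  pose proof (RInt_nonneg g b' b H3 Hg Hp).
  enough ((b' - a') * m <= RInt g a' b') by lra.
  rewrite <- RInt_cst. apply RInt_le; [exact H2|apply ex_RInt_const|now apply ex_RInt_cont|].
  intros t Ht; apply Hm; lra.
Qed.

Lemma RInt_support (g : R -> R) r a b :
  0 <= r -> a <= - r -> r <= b -> (forall t, continuous g t) ->
  (forall t, r < Rabs t -> g t = 0) -> RInt g a b = RInt g (- r) r.
Proof.
  intros Hr Ha Hb Hg Hs.
  rewrite (RInt_split g a (- r) b), (RInt_split g (- r) r b) by exact Hg.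
  assert (Z : forall c d, c <= d -> (forall t, c < t < d -> g t = 0) -> RInt g c d = 0).
  { intros c d Hcd H. rewrite (RInt_ext g (fun _ => 0)), RInt_cst; [apply Rmult_0_r|].
    intros t. rewrite Rmin_left, Rmax_right by exact Hcd. apply H. }
  rewrite (Z a (- r)), (Z r b); trivial.
  - now rewrite Rplus_0_l, Rplus_0_r.
  - intros t Ht; apply Hs. rewrite Rabs_pos_eq; lra.
  - intros t Ht; apply Hs. rewrite Rabs_left1; lra.
Qed.

(** The margin r + 1 <= M ensures that the window [-M + s, M + s] still contains the support
    [-r, r], so both integrals reduce to the one over [-r, r]. *)
Lemma RInt_translate_support (g : R -> R) r M s :
  0 <= r -> r + 1 <= M -> Rabs s <= 1 -> (forall t, continuous g t) ->
  (forall t, r < Rabs t -> g t = 0) ->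
  RInt (fun t => g (t + s)) (- M) M = RInt g (- M) M.
Proof.
  intros Hr HM Hs Hg Hsupp. apply Rabs_le_between in Hs.
  rewrite RInt_translate by exact Hg.
  rewrite (RInt_support g r (- M + s)), (RInt_support g r (- M)); trivial; lra.
Qed.

(** * Iterated integrals over the square of half-side M, standing for plane integrals of compactly
    supported functions *)

Definition plane_int (M : R) (F : R * R -> R) : R :=
  RInt (fun x => RInt (fun y => F (x, y)) (- M) M) (- M) M.

Section PlaneIntegral.
Variable M : R.
Hypothesis M_pos : 0 <= M.
Implicit Types F G : R * R -> R.

Lemma continuous_slice F x y :
  (forall p, continuous F p) -> continuous (fun s => F (x, s)) y.
Proof. intros H. apply (continuous_section_l (U := R_UniformSpace) (V := R_UniformSpace)), H. Qed.

Lemma continuous_slice_int F a b x :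
  (forall p, continuous F p) -> continuous (fun x => RInt (fun y => F (x, y)) a b) x.
Proof. intros H. apply (continuous_RInt_param (U := R_UniformSpace)), H. Qed.

Hint Resolve continuous_slice continuous_slice_int : core.

Lemma plane_int_eq F G : (forall p, F p = G p) -> plane_int M F = plane_int M G.
Proof. intros H. apply RInt_eq; intros x. now apply RInt_eq. Qed.

Lemma plane_int_le F G :
  (forall p, continuous F p) -> (forall p, continuous G p) ->
  (forall p, F p <= G p) -> plane_int M F <= plane_int M G.
Proof.
  intros HF HG H. apply RInt_mono; [lra|auto|auto|].
  intros x. apply RInt_mono; [lra|auto|auto|auto].
Qed.

Lemma plane_int_plus F G :
  (forall p, continuous F p) -> (forall p, continuous G p) ->
  plane_int M (fun p => F p + G p) = plane_int M F + plane_int M G.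
Proof.
  intros HF HG. unfold plane_int. rewrite <- RInt_Rplus by auto.
  apply RInt_eq; intros x. apply RInt_Rplus; auto.
Qed.

Lemma plane_int_minus F G :
  (forall p, continuous F p) -> (forall p, continuous G p) ->
  plane_int M (fun p => F p - G p) = plane_int M F - plane_int M G.
Proof.
  intros HF HG. unfold plane_int. rewrite <- RInt_Rminus by auto.
  apply RInt_eq; intros x. apply RInt_Rminus; auto.
Qed.

Lemma plane_int_scal k F :
  (forall p, continuous F p) -> plane_int M (fun p => k * F p) = k * plane_int M F.
Proof.
  intros HF. unfold plane_int. rewrite <- RInt_Rscal by auto.
  apply RInt_eq; intros x. apply RInt_Rscal; auto.
Qed.

Lemma plane_int_ge_box F x0 y0 d m :
  - M <= x0 -> x0 + d <= M -> - M <= y0 -> y0 + d <= M -> 0 <= d ->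
  (forall p, continuous F p) -> (forall p, 0 <= F p) ->
  (forall x y, x0 <= x <= x0 + d -> y0 <= y <= y0 + d -> m <= F (x, y)) ->
  d * (d * m) <= plane_int M F.
Proof.
  intros H1 H2 H3 H4 Hd HF Hp Hm.
  replace (d * (d * m)) with ((x0 + d - x0) * (d * m)) by ring.
  apply RInt_ge_sub; [lra..|auto| |].
  - intros x. apply RInt_nonneg; [lra|auto|auto].
  - intros x Hx. replace (d * m) with ((y0 + d - y0) * m) by ring.
    apply RInt_ge_sub; [lra..|auto|auto|auto].
Qed.

Lemma plane_int_translate F r s1 s2 :
  0 <= r -> r + 1 <= M -> Rabs s1 <= 1 -> Rabs s2 <= 1 ->
  (forall p, continuous F p) ->
  (forall x y, r < Rabs x \/ r < Rabs y -> F (x, y) = 0) ->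
  plane_int M (fun p => F (fst p + s1, snd p + s2)) = plane_int M F.
Proof.
  intros Hr HM H1 H2 HF Hs. unfold plane_int; simpl.
  rewrite (RInt_eq _ (fun x => RInt (fun y => F (x + s1, y)) (- M) M)).
  - apply (RInt_translate_support (fun x => RInt (fun y => F (x, y)) (- M) M) r); auto.
    intros x Hx. rewrite (RInt_eq _ (fun _ => 0)); [rewrite RInt_cst; ring|auto].
  - intros x. apply (RInt_translate_support (fun y => F (x + s1, y)) r); auto.
Qed.

End PlaneIntegral.

#[local] Hint Resolve continuous_slice continuous_slice_int : core.

(** The one-variable parameter lemma is used twice, the inner time with (v, x) as parameter; the
    pairs are reassociated so that the integration variable comes last. *)
Lemma continuous_plane_int {U : UniformSpace} M (G : U * (R * R) -> R) u :
  (forall z, continuous G z) -> continuous (fun v => plane_int M (fun p => G (v, p))) u.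
Proof.
  intros HG.
  apply (continuous_RInt_param
           (fun vx : U * R => RInt (fun y => G (fst vx, (snd vx, y))) (- M) M)).
  intros vx.
  apply (continuous_RInt_param (U := prod_UniformSpace U R_UniformSpace)
           (fun z : U * R * R => G (fst (fst z), (snd (fst z), snd z)))).
  intros [[v x] y].
  apply (continuous_comp (fun z : U * R * R => (fst (fst z), (snd (fst z), snd z))) G);
    [|apply HG].
  assert (H1 : continuous (fst : U * R * R -> U * R) (v, x, y)) by apply continuous_fst.
  repeat apply continuous_pair.
  - apply (continuous_comp fst fst); [exact H1|apply continuous_fst].
  - apply (continuous_comp fst snd); [exact H1|apply continuous_snd].
  - apply continuous_snd.
Qed.

(** Two uses of [RInt_Fubini]: t is exchanged first with x, then with y. *)
Lemma RInt_plane_int_swap (G : R * (R * R) -> R) M a b :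
  (forall z, continuous G z) ->
  RInt (fun t => plane_int M (fun p => G (t, p))) a b =
  plane_int M (fun p => RInt (fun t => G (t, p)) a b).
Proof.
  intros HG. unfold plane_int.
  rewrite (RInt_Fubini (fun tx => RInt (fun y => G (fst tx, (snd tx, y))) (- M) M)).
  - apply RInt_eq; intros x; simpl.
    apply (RInt_Fubini (fun ty => G (fst ty, (x, snd ty)))). intros [t y].
    apply (continuous_comp (fun ty : R * R => (fst ty, (x, snd ty))) G); [|apply HG].
    repeat apply continuous_pair;
      [apply continuous_fst|apply continuous_const|apply continuous_snd].
  - intros tx.
    apply (continuous_RInt_param (U := prod_UniformSpace R_UniformSpace R_UniformSpace)
           (fun z : R * R * R => G (fst (fst z), (snd (fst z), snd z)))).
    intros [[v x] y].
    apply (continuous_comp (fun z : R * R * R => (fst (fst z), (snd (fst z), snd z))) G);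
      [|apply HG].
    assert (H1 : continuous (fst : R * R * R -> R * R) (v, x, y)) by apply continuous_fst.
    repeat apply continuous_pair.
    + apply (continuous_comp fst fst); [exact H1|apply continuous_fst].
    + apply (continuous_comp fst snd); [exact H1|apply continuous_snd].
    + apply continuous_snd.
Qed.

(** * Truncation to [0, 1] and increments of the logarithm *)

Definition clamp (u : R) : R := (Rabs u - Rabs (u - 1) + 1) / 2.

(** The formula of [clamp] is min(1, max(0, u)) written with absolute values, which reduces
    continuity to that of [Rabs] and this bound to sign cases. *)
Lemma clamp_lipschitz u v : (clamp u - clamp v) ^ 2 <= (u - v) ^ 2.
Proof.
  rewrite <- !Rsqr_pow2. apply Rsqr_le_abs_1. unfold clamp, Rabs; repeat destruct Rcase_abs; lra.
Qed.

Lemma clamp_one u : 1 <= u -> clamp u = 1.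
Proof. intros H. unfold clamp. rewrite !Rabs_pos_eq; lra. Qed.

Lemma clamp_zero u : u <= 0 -> clamp u = 0.
Proof. intros H. unfold clamp. rewrite !Rabs_left1; lra. Qed.

Lemma ln_le_sub_one z : 0 < z -> ln z <= z - 1.
Proof. intros H. pose proof (exp_ineq1_le (ln z)). rewrite exp_ln in H0; lra. Qed.

Lemma ln_sub_le u v : 0 < u -> 0 < v -> ln u - ln v <= (u - v) / v.
Proof.
  intros Hu Hv. rewrite <- ln_div by assumption.
  replace ((u - v) / v) with (u / v - 1) by (field; lra).
  apply ln_le_sub_one, Rdiv_lt_0_compat; assumption.
Qed.

(** With p = (x, y) and e = (a, b), a unit step changes |p|^2 by O(1 + |p|), so its logarithm
    changes by O(1/|p|) at infinity. The squared increment is thus of the order of 1/|p|^2, whose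
    plane integral diverges only logarithmically. *)
Lemma ln_one_plus_norm_step x y a b :
  a * a + b * b = 1 ->
  (ln (1 + x * x + y * y) - ln (1 + (x + a) * (x + a) + (y + b) * (y + b))) ^ 2
    <= 45 * / (1 + x * x + y * y).
Proof.
  intros Hab.
  set (A := 1 + x * x + y * y). set (B := 1 + (x + a) * (x + a) + (y + b) * (y + b)).
  assert (HA : 0 < A) by (unfold A; nra).
  assert (HB : 0 < B) by (unfold B; pose proof (Rle_0_sqr (x + a)); pose proof (Rle_0_sqr (y + b)); unfold Rsqr in *; lra).
  (* Indeed 3B - A = |2p + 3e|^2 / 2 + 1/2. *)
  assert (H3 : A <= 3 * B).
  { unfold A, B. pose proof (Rle_0_sqr (2 * x + 3 * a)). pose proof (Rle_0_sqr (2 * y + 3 * b)).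
    unfold Rsqr in *. lra. }
  set (s := a * x + b * y).
  (* Cauchy-Schwarz for s = e.p, by Lagrange's identity and |e| = 1. *)
  assert (Hs : s * s <= x * x + y * y).
  { pose proof (Rle_0_sqr (a * y - b * x)). unfold Rsqr in *.
    replace (x * x + y * y) with ((a * a + b * b) * (x * x + y * y)) by (rewrite Hab; ring).
    unfold s. lra. }
  assert (HBA : B - A = 2 * s + 1) by (unfold A, B, s; lra).
  (* Since s^2 <= |p|^2, the difference 5A - (2s + 1)^2 is at least (s - 2)^2. *)
  assert (H5 : (B - A) * (B - A) <= 5 * A).
  { rewrite HBA. pose proof (Rle_0_sqr (s - 2)). unfold Rsqr in *. unfold A. lra. }
  pose proof (ln_sub_le A B HA HB) as L1. pose proof (ln_sub_le B A HB HA) as L2.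
  (* The two one-sided bounds have denominators B and A; as 1/B <= 3/A, both are at most 3|B - A|/A.
     Squaring and using (B - A)^2 <= 5A gives 9 * 5 = 45. *)
  apply Rle_trans with ((3 * (Rabs (B - A) / A)) ^ 2).
  - apply pow_maj_Rabs.
    assert (iA : 0 < / A) by now apply Rinv_0_lt_compat.
    assert (iB : 0 < / B) by now apply Rinv_0_lt_compat.
    assert (iBA : / B <= 3 * / A).
    { apply Rmult_le_reg_r with (A * B); [now apply Rmult_lt_0_compat|].
      replace (/ B * (A * B)) with A by (field; lra).
      replace (3 * / A * (A * B)) with (3 * B) by (field; lra). exact H3. }
    assert (P := Rabs_pos (B - A)).
    unfold Rdiv in *. apply Rabs_le; split.
    + pose proof (Rle_abs (B - A)). nra.
    + pose proof (Rabs_maj2 (B - A)).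
      apply Rle_trans with (1 := L1).
      apply Rle_trans with (Rabs (B - A) * / B); [apply Rmult_le_compat_r; lra|nra].
  - replace ((3 * (Rabs (B - A) / A)) ^ 2)
      with (9 * (Rabs (B - A) * Rabs (B - A)) * / A * / A) by (field; lra).
    rewrite <- Rabs_mult, Rabs_pos_eq by apply Rle_0_sqr.
    replace (45 * / A) with (9 * (5 * A) * / A * / A) by (field; lra).
    apply Rmult_le_compat_r; [left; now apply Rinv_0_lt_compat|].
    apply Rmult_le_compat_r; [left; now apply Rinv_0_lt_compat|]. lra.
Qed.

(** * Automation of continuity proofs *)

Lemma continuous_fst' {U V W : UniformSpace} (f : U -> V * W) (x : U) :
  continuous f x -> continuous (fun y => fst (f y)) x.
Proof.
  intros H. apply (continuous_comp f fst); [exact H|].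
  destruct (f x); apply continuous_fst.
Qed.

Lemma continuous_snd' {U V W : UniformSpace} (f : U -> V * W) (x : U) :
  continuous f x -> continuous (fun y => snd (f y)) x.
Proof.
  intros H. apply (continuous_comp f snd); [exact H|].
  destruct (f x); apply continuous_snd.
Qed.

Lemma continuous_cos' {U : UniformSpace} (f : U -> R) (x : U) :
  continuous f x -> continuous (fun y => cos (f y)) x.
Proof. intros H. apply (continuous_comp f cos); [exact H|apply continuous_cos]. Qed.

Lemma continuous_sin' {U : UniformSpace} (f : U -> R) (x : U) :
  continuous f x -> continuous (fun y => sin (f y)) x.
Proof. intros H. apply (continuous_comp f sin); [exact H|apply continuous_sin]. Qed.

(** Descends along the syntax of the function. The case [?F (@?a z)] composes with a function whose
    continuity is found by [auto]; nonvanishing of denominators is left as a goal. *)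
Ltac cont :=
  lazymatch goal with
  | |- forall _, _ => intros ?; cont
  | |- continuous (fun _ => ?c) _ => apply continuous_const
  | |- continuous (fun z => z) _ => apply continuous_id
  | |- continuous fst _ => exact (continuous_fst' _ _ (continuous_id _))
  | |- continuous snd _ => exact (continuous_snd' _ _ (continuous_id _))
  | |- continuous cos _ => apply continuous_cos
  | |- continuous sin _ => apply continuous_sin
  | |- continuous (fun z => fst _) _ => apply continuous_fst'; cont
  | |- continuous (fun z => snd _) _ => apply continuous_snd'; cont
  | |- continuous (fun z => cos _) _ => apply continuous_cos'; cont
  | |- continuous (fun z => sin _) _ => apply continuous_sin'; cont
  | |- continuous (fun z => (_, _)) _ => apply continuous_pair; cont
  | |- continuous (fun z => _ + _) _ => apply continuous_Rplus; cont
  | |- continuous (fun z => _ - _) _ => apply continuous_Rminus; cont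
  | |- continuous (fun z => _ * _) _ => apply continuous_Rmult; cont
  | |- continuous (fun z => _ / _) _ => apply continuous_Rdiv; [cont|cont|]
  | |- continuous (fun z => Rabs _) _ => apply continuous_abs; cont
  | |- continuous (fun z => ?F (@?a z)) _ =>
      apply (continuous_comp a F); [cont|try solve [auto]]
  | _ => try solve [auto]
  end.

(** * The logarithmic cutoff and its energy *)

Lemma plane_int_inv_norm M L :
  0 <= M -> M <= sinh L ->
  plane_int M (fun p => 1 / (1 + fst p * fst p + snd p * snd p)) <= 2 * PI * L.
Proof.
  intros HM HL.
  assert (Hpos : forall x y, 1 + x * x + y * y <> 0) by (intros; nra).
  assert (Hsq : forall x, 0 < sqrt (x ^ 2 + 1)) by (intros; apply sqrt_lt_R0; nra).
  assert (Hsqc : forall x, continuous (fun x => 1 / sqrt (x ^ 2 + 1)) x).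
  { intros x. apply continuous_Rdiv; [cont| |specialize (Hsq x); lra].
    apply (continuous_comp (fun x => x ^ 2 + 1) sqrt); [|apply continuous_sqrt].
    apply continuous_Rplus; [|cont]. simpl. cont. }
  (* The inner integral is a difference of arctangents, at most pi, divided by sqrt(1 + x^2). The
     outer one then gives 2 pi arcsinh M, so the growth in M is logarithmic. *)
  apply Rle_trans with (RInt (fun x => PI * (1 / sqrt (x ^ 2 + 1))) (- M) M).
  - apply RInt_mono; [lra| | |].
    + intros x. apply (continuous_slice_int (fun p => 1 / (1 + fst p * fst p + snd p * snd p))).
      cont. apply Hpos.
    + intros x. apply continuous_Rmult; [cont|apply Hsqc].
    + intros x; simpl. set (s := sqrt (x ^ 2 + 1)).
      assert (Hs : 0 < s) by apply Hsq.
      assert (Hss : s * s = x ^ 2 + 1) by (apply sqrt_sqrt; nra).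
      assert (HI : is_RInt (fun y => 1 / (1 + x * x + y * y)) (- M) M
                     (minus (atan (M / s) / s) (atan (- M / s) / s))).
      { apply (is_RInt_derive (V := R_CompleteNormedModule) (fun y => atan (y / s) / s)).
        - intros y _. auto_derive; [trivial|].
          replace (1 + x * x + y * y) with (s * s + y * y) by (rewrite Hss; ring).
          field. split; nra.
        - intros y _. cont. apply Hpos. }
      rewrite (is_RInt_unique _ _ _ _ HI). unfold minus, plus, opp; simpl.
      pose proof (atan_bound (M / s)). pose proof (atan_bound (- M / s)).
      replace (atan (M / s) / s + - (atan (- M / s) / s))
        with ((atan (M / s) - atan (- M / s)) * (1 / s)) by (field; lra).
      apply Rmult_le_compat_r; [|lra].
      left. apply Rdiv_lt_0_compat; [apply Rlt_0_1|exact Hs].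
  - rewrite RInt_Rscal by exact Hsqc.
    assert (HI : is_RInt (fun x => 1 / sqrt (x ^ 2 + 1)) (- M) M
                     (minus (arcsinh M) (arcsinh (- M)))).
    { apply (is_RInt_derive (V := R_CompleteNormedModule) arcsinh).
      - intros y _. apply is_derive_Reals.
        replace (1 / sqrt (y ^ 2 + 1)) with (/ sqrt (y ^ 2 + 1)) by (field; specialize (Hsq y); lra).
        apply derivable_pt_lim_arcsinh.
      - intros; apply Hsqc. }
    rewrite (is_RInt_unique _ _ _ _ HI). unfold minus, plus, opp; simpl.
    assert (H1 : arcsinh M <= L).
    { rewrite <- (arcsinh_sinh L). now apply arcsinh_le. }
    assert (H2 : - L <= arcsinh (- M)).
    { rewrite <- (arcsinh_sinh (- L)). apply arcsinh_le.
      replace (sinh (- L)) with (- sinh L); [lra|]. unfold sinh. rewrite Ropp_involutive. field. }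
    pose proof PI_RGT_0. nra.
Qed.

(** It is 1 where 1 + |p|^2 <= e^K, 0 where 1 + |p|^2 >= e^(2K), and affine in ln(1 + |p|^2) in
    between: the usual test functions showing that the plane has zero capacity at infinity. *)
Definition cutoff (K : R) (p : R * R) : R :=
  clamp (2 - ln (1 + fst p * fst p + snd p * snd p) / K).

Section Cutoff.
Variable K : R.
Hypothesis K_ge_1 : 1 <= K.

Lemma continuous_cutoff p : continuous (cutoff K) p.
Proof.
  unfold cutoff, clamp.
  assert (H : continuous (fun p : R * R => ln (1 + fst p * fst p + snd p * snd p)) p).
  { apply (continuous_comp (fun p : R * R => 1 + fst p * fst p + snd p * snd p) ln); [cont|].
    apply continuous_ln; nra. }
  assert (H' : continuous
            (fun p : R * R => 2 - ln (1 + fst p * fst p + snd p * snd p) / K) p).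
  { apply continuous_Rminus; [cont|]. apply continuous_Rdiv; [exact H|cont|lra]. }
  apply continuous_Rdiv; [|cont|lra]. apply continuous_Rplus; [|cont].
  apply continuous_Rminus; apply continuous_abs; [exact H'|].
  apply continuous_Rminus; [exact H'|cont].
Qed.

Lemma cutoff_one x y : 1 + x * x + y * y <= exp K -> cutoff K (x, y) = 1.
Proof.
  intros H. apply clamp_one; simpl.
  assert (ln (1 + x * x + y * y) <= K) by (rewrite <- (ln_exp K); apply ln_le; nra).
  assert (ln (1 + x * x + y * y) / K <= 1) by (apply Rle_div_l; lra). lra.
Qed.

Lemma cutoff_zero x y : exp K < Rabs x \/ exp K < Rabs y -> cutoff K (x, y) = 0.
Proof.
  intros H. apply clamp_zero; simpl.
  assert (HE := exp_pos K).
  assert (E : exp (K + K) <= 1 + x * x + y * y).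
  { rewrite exp_plus.
    assert (Sq : forall z, exp K < Rabs z -> exp K * exp K <= z * z).
    { intros z Hz. change (z * z) with (Rsqr z). rewrite Rsqr_abs. unfold Rsqr. nra. }
    destruct H as [H|H]; apply Sq in H; nra. }
  assert (K + K <= ln (1 + x * x + y * y)).
  { rewrite <- (ln_exp (K + K)). apply ln_le; [apply exp_pos|exact E]. }
  assert (2 <= ln (1 + x * x + y * y) / K) by (apply Rle_div_r; lra). lra.
Qed.

Lemma cutoff_energy_density p a b :
  a * a + b * b = 1 ->
  (cutoff K p - cutoff K (fst p + a, snd p + b)) ^ 2
    <= 45 / (K * K) * (1 / (1 + fst p * fst p + snd p * snd p)).
Proof.
  intros Hab. destruct p as [x y]; simpl fst; simpl snd.
  eapply Rle_trans; [apply clamp_lipschitz|]; simpl fst; simpl snd.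
  pose proof (ln_one_plus_norm_step x y a b Hab) as H.
  set (u := ln (1 + x * x + y * y)) in *.
  set (v := ln (1 + (x + a) * (x + a) + (y + b) * (y + b))) in *.
  replace ((2 - u / K - (2 - v / K)) ^ 2) with (/ (K * K) * (u - v) ^ 2) by (field; lra).
  replace (45 / (K * K) * (1 / (1 + x * x + y * y)))
    with (/ (K * K) * (45 * / (1 + x * x + y * y))) by (field; split; nra).
  apply Rmult_le_compat_l; [|exact H]. left; apply Rinv_0_lt_compat; nra.
Qed.

(** The density is at most 45/K^2 times 1/(1 + |p|^2), and the integral of the latter over a square
    of half-side about e^K is O(K). The energy is therefore O(1/K), uniformly in the direction of
    the step. *)
Lemma cutoff_energy a b :
  a * a + b * b = 1 ->
  plane_int (exp K + 1) (fun p =>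
    (cutoff K p - cutoff K (fst p + a, snd p + b)) * (cutoff K p - cutoff K (fst p + a, snd p + b)))
    <= 450 * PI / K.
Proof.
  intros Hab.
  assert (HM : 0 <= exp K + 1) by (pose proof (exp_pos K); lra).
  pose proof continuous_cutoff as Hc.
  assert (Hd : forall p : R * R,
            continuous (fun p => 1 / (1 + fst p * fst p + snd p * snd p)) p).
  { cont. nra. }
  apply Rle_trans with (plane_int (exp K + 1)
    (fun p => 45 / (K * K) * (1 / (1 + fst p * fst p + snd p * snd p)))).
  - apply plane_int_le; [exact HM|cont| |].
    + intros p. apply continuous_Rmult; [cont|apply Hd].
    + intros p. pose proof (cutoff_energy_density p a b Hab). lra.
  - rewrite plane_int_scal by exact Hd.
    (* From e^4 >= 5 one gets 2 sinh(K + 4) >= 5 e^K - 1, which is at least 2 e^K + 2 because e^K >=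
       1. *)
    assert (HL : exp K + 1 <= sinh (K + 4)).
    { unfold sinh. rewrite exp_plus.
      pose proof (exp_ineq1_le 4). pose proof (exp_ineq1_le K).
      assert (exp (- (K + 4)) <= 1).
      { rewrite <- exp_0. left; apply exp_increasing; lra. }
      nra. }
    pose proof (plane_int_inv_norm _ _ HM HL) as H. pose proof PI_RGT_0.
    assert (iK : 0 < 45 / (K * K)) by (apply Rdiv_lt_0_compat; nra).
    (* K + 4 <= 5K because K >= 1. *)
    apply Rle_trans with (45 / (K * K) * (2 * PI * (5 * K))).
    + apply Rmult_le_compat_l; [lra|]. eapply Rle_trans; [exact H|]. nra.
    + right. field. lra.
Qed.

End Cutoff.

(** * Positive functions with the unit mean value property: the energy identity *)

Section UnitMean.
Variable F : R * R -> R.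
Hypothesis F_cont : forall p, continuous F p.
Hypothesis F_pos : forall p, 0 < F p.
Hypothesis F_mean : forall p,
  RInt (fun t => F (fst p + cos t, snd p + sin t)) 0 (2 * PI) = 2 * PI * F p.

Lemma F_neq0 p : F p <> 0.
Proof. specialize (F_pos p); lra. Qed.

Hint Resolve F_neq0 : core.

(* The half-turn t -> t + PI maps the unit circle to itself by e^{it} -> - e^{it}. *)
Lemma mean_reflected p :
  RInt (fun t => F (fst p - cos t, snd p - sin t)) 0 (2 * PI) = 2 * PI * F p.
Proof.
  set (g := fun t => F (fst p + cos t, snd p + sin t)).
  assert (Hg : forall t, continuous g t) by (unfold g; cont).
  assert (Hp : forall t, g (t + 2 * PI) = g t).
  { intros t. unfold g. replace (t + 2 * PI) with (t + PI + PI) by ring.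
    now rewrite !neg_cos, !neg_sin, !Ropp_involutive. }
  rewrite (RInt_eq _ (fun t => g (t + PI))).
  2: { intros t. unfold g. rewrite neg_cos, neg_sin. reflexivity. }
  rewrite RInt_translate, <- F_mean by exact Hg. fold g.
  rewrite (RInt_split g (0 + PI) (2 * PI) (2 * PI + PI)) by exact Hg.
  rewrite (RInt_split g 0 PI (2 * PI)) by exact Hg.
  replace (RInt g (2 * PI) (2 * PI + PI)) with (RInt g 0 PI).
  - rewrite Rplus_0_l. apply Rplus_comm.
  - rewrite (RInt_eq g (fun t => g (t + 2 * PI))) at 1 by (intros; symmetry; apply Hp).
    rewrite RInt_translate by exact Hg. f_equal; ring.
Qed.

(** After exchanging the integrals, the mean value at p turns the t-integral of F(p + e) into 2 pi
    F(p), which cancels the denominator. *)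
Lemma weighted_mean (M : R) (h : R * R -> R) :
  (forall p, continuous h p) ->
  RInt (fun t => plane_int M (fun p => h p * F (fst p + cos t, snd p + sin t) / F p))
    0 (2 * PI) = 2 * PI * plane_int M h.
Proof.
  intros Hh.
  rewrite (RInt_plane_int_swap (fun z =>
    h (snd z) * F (fst (snd z) + cos (fst z), snd (snd z) + sin (fst z)) / F (snd z))).
  2: cont; auto.
  rewrite <- plane_int_scal by exact Hh.
  apply plane_int_eq. intros p; simpl.
  rewrite (RInt_eq _ (fun t => h p / F p * F (fst p + cos t, snd p + sin t)))
    by (intros; field; auto).
  rewrite RInt_Rscal, F_mean by cont. field; auto.
Qed.

(** The substitution p -> p - e moves the weight back to p and turns the quotient into F(p -
    e)/F(p); then [mean_reflected] plays the part of the mean value property. The support of h makes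
    the substitution legitimate on a bounded square. *)
Lemma weighted_mean_translated (M r : R) (h : R * R -> R) :
  0 <= r -> r + 1 <= M -> (forall p, continuous h p) ->
  (forall x y, r < Rabs x \/ r < Rabs y -> h (x, y) = 0) ->
  RInt (fun t => plane_int M (fun p =>
      h (fst p + cos t, snd p + sin t) * F p / F (fst p + cos t, snd p + sin t)))
    0 (2 * PI) = 2 * PI * plane_int M h.
Proof.
  intros Hr HM Hh Hs.
  rewrite (RInt_eq _ (fun t =>
    plane_int M (fun p => h p * F (fst p - cos t, snd p - sin t) / F p))).
  - rewrite (RInt_plane_int_swap (fun z =>
      h (snd z) * F (fst (snd z) - cos (fst z), snd (snd z) - sin (fst z)) / F (snd z))).
    2: cont; auto.
    rewrite <- plane_int_scal by exact Hh.
    apply plane_int_eq. intros p; simpl.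
    rewrite (RInt_eq _ (fun t => h p / F p * F (fst p - cos t, snd p - sin t)))
      by (intros; field; auto).
    rewrite RInt_Rscal, mean_reflected by cont. field; auto.
  - intros t.
    rewrite <- (plane_int_translate M
      (fun p => h p * F (fst p - cos t, snd p - sin t) / F p) r (cos t) (sin t)).
    + apply plane_int_eq. intros [x y]; simpl.
      now replace (x + cos t - cos t, y + sin t - sin t) with (x, y) by (f_equal; ring).
    + exact Hr.
    + exact HM.
    + apply Rabs_le, COS_bound.
    + apply Rabs_le, SIN_bound.
    + cont; auto.
    + intros x y Hxy. rewrite Hs by exact Hxy. unfold Rdiv; ring.
Qed.

Lemma translated_total (M r : R) (h : R * R -> R) :
  0 <= r -> r + 1 <= M -> (forall p, continuous h p) ->
  (forall x y, r < Rabs x \/ r < Rabs y -> h (x, y) = 0) ->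
  RInt (fun t => plane_int M (fun p => h (fst p + cos t, snd p + sin t))) 0 (2 * PI)
  = 2 * PI * plane_int M h.
Proof.
  intros Hr HM Hh Hs.
  rewrite (RInt_eq _ (fun _ => plane_int M h)); [now rewrite RInt_cst, Rminus_0_r|].
  intros t. apply (plane_int_translate M h r); trivial;
    apply Rabs_le; [apply COS_bound|apply SIN_bound].
Qed.

(* Pointwise both integrands contain the cross term - 2 eta(p) eta(p + e^{it}); the
   remaining terms integrate to the same value, by the mean value property on the left. *)
Lemma ground_state_identity (M r : R) (eta : R * R -> R) :
  0 <= r -> r + 1 <= M -> (forall p, continuous eta p) ->
  (forall x y, r < Rabs x \/ r < Rabs y -> eta (x, y) = 0) ->
  RInt (fun t => plane_int M (fun p =>
      (eta p * F (fst p + cos t, snd p + sin t) - eta (fst p + cos t, snd p + sin t) * F p)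
      * (eta p * F (fst p + cos t, snd p + sin t) - eta (fst p + cos t, snd p + sin t) * F p)
      / (F p * F (fst p + cos t, snd p + sin t)))) 0 (2 * PI) =
  RInt (fun t => plane_int M (fun p =>
      (eta p - eta (fst p + cos t, snd p + sin t))
      * (eta p - eta (fst p + cos t, snd p + sin t)))) 0 (2 * PI).
Proof.
  intros Hr HM He Hs.
  assert (Hh : forall p, continuous (fun p => eta p * eta p) p) by cont.
  assert (Hsh : forall x y, r < Rabs x \/ r < Rabs y -> eta (x, y) * eta (x, y) = 0).
  { intros x y H. rewrite Hs by exact H. ring. }
  set (tr := fun t (p : R * R) => (fst p + cos t, snd p + sin t)).
  set (T1 := fun t => plane_int M (fun p => eta p * eta p * F (tr t p) / F p)).
  set (T2 := fun t => plane_int M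
              (fun p => eta (tr t p) * eta (tr t p) * F p / F (tr t p))).
  set (T3 := fun t => plane_int M (fun p => eta (tr t p) * eta (tr t p))).
  set (T4 := plane_int M (fun p => eta p * eta p)).
  set (X := fun t => plane_int M (fun p => 2 * (eta p * eta (tr t p)))).
  assert (E1 : RInt T1 0 (2 * PI) = 2 * PI * T4).
  { exact (weighted_mean M (fun p => eta p * eta p) Hh). }
  assert (E2 : RInt T2 0 (2 * PI) = 2 * PI * T4).
  { exact (weighted_mean_translated M r (fun p => eta p * eta p) Hr HM Hh Hsh). }
  assert (E3 : RInt T3 0 (2 * PI) = 2 * PI * T4).
  { exact (translated_total M r (fun p => eta p * eta p) Hr HM Hh Hsh). }
  assert (C1 : forall t, continuous T1 t).
  { intros t. apply (continuous_plane_int M (fun z =>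
      eta (snd z) * eta (snd z) * F (tr (fst z) (snd z)) / F (snd z))). unfold tr; cont; auto. }
  assert (C2 : forall t, continuous T2 t).
  { intros t. apply (continuous_plane_int M (fun z =>
      eta (tr (fst z) (snd z)) * eta (tr (fst z) (snd z)) * F (snd z) / F (tr (fst z) (snd z)))).
    unfold tr; cont; auto. }
  assert (C3 : forall t, continuous T3 t).
  { intros t. apply (continuous_plane_int M (fun z =>
      eta (tr (fst z) (snd z)) * eta (tr (fst z) (snd z)))). unfold tr; cont. }
  assert (CX : forall t, continuous X t).
  { intros t. apply (continuous_plane_int M (fun z =>
      2 * (eta (snd z) * eta (tr (fst z) (snd z))))). unfold tr; cont. }
  rewrite (RInt_eq _ (fun t => (T1 t + T2 t) - X t)).
  - rewrite (RInt_eq (fun t => plane_int M _) (fun t => (T4 + T3 t) - X t)).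
    + rewrite !RInt_Rminus, !RInt_Rplus by (try exact CX; try exact C1; try exact C2;
        try exact C3; intros; try apply continuous_Rplus; auto; cont).
      rewrite E1, E2, E3, RInt_cst. f_equal. f_equal. ring.
    + intros t. unfold T4, T3, X, tr.
      rewrite <- plane_int_plus, <- plane_int_minus by cont.
      apply plane_int_eq; intros p. ring.
  - intros t. unfold T1, T2, X, tr.
    rewrite <- plane_int_plus by (cont; auto).
    rewrite <- plane_int_minus by (cont; auto).
    apply plane_int_eq; intros p. field. split; auto.
Qed.

(** A failure at one (t, p) makes the squared difference bounded below on a small box in (t, p), so
    the left side of [ground_state_identity] stays above a fixed v > 0 for every cutoff equal to 1
    near that box. The right side is O(1/K), a contradiction for large K. *)
Lemma unit_step_invariant p t :
  0 <= t < 2 * PI -> F (fst p + cos t, snd p + sin t) = F p.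
Proof.
  intros Ht. apply NNPP. intros Hne. destruct p as [x0 y0].
  (* The left integrand of [ground_state_identity] where eta is 1 at both p and p + e. *)
  set (q := fun z : R * (R * R) =>
    (F (fst (snd z) + cos (fst z), snd (snd z) + sin (fst z)) - F (snd z))
    * (F (fst (snd z) + cos (fst z), snd (snd z) + sin (fst z)) - F (snd z))
    / (F (snd z) * F (fst (snd z) + cos (fst z), snd (snd z) + sin (fst z)))).
  assert (FF : forall p p', 0 < F p * F p') by (intros; now apply Rmult_lt_0_compat).
  assert (Hq : continuous q (t, (x0, y0))).
  { unfold q; cont. apply Rgt_not_eq, FF. }
  assert (Hq0 : 0 < q (t, (x0, y0))).
  { apply Rdiv_lt_0_compat; [|apply FF]. simpl in *. apply Rsqr_pos_lt. lra. }
  set (m := q (t, (x0, y0)) / 2).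
  assert (Hm : 0 < m) by (unfold m; lra).
  destruct (proj1 (filterlim_locally _ _) Hq (mkposreal m Hm)) as [delta Hdelta].
  pose proof (cond_pos delta) as Hdp.
  (* The second bound keeps [t, t + d] inside the range of integration [0, 2 pi]; it is positive
     because t < 2 pi. *)
  set (d := Rmin (delta / 2) (2 * PI - t)).
  assert (Hd : 0 < d) by (apply Rmin_pos; lra).
  assert (Hd1 : d <= delta / 2) by apply Rmin_l.
  assert (Hd2 : d <= 2 * PI - t) by apply Rmin_r.
  assert (Hbox : forall s x y, t <= s <= t + d -> x0 <= x <= x0 + d -> y0 <= y <= y0 + d ->
            m <= q (s, (x, y))).
  { intros s x y Hs Hx Hy.
    assert (B : forall u v, u <= v <= u + d -> Rabs (v - u) < delta)
      by (intros; rewrite Rabs_pos_eq; lra).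
    assert (H : Rabs (q (s, (x, y)) - q (t, (x0, y0))) < m).
    { apply Hdelta. split; [|split]; now apply B. }
    apply Rabs_lt_between in H. unfold m in *; lra. }
  (* The term d covers the box around (x0, y0), the term 1 the unit step away from it. *)
  set (a := Rabs x0 + d + 1). set (b := Rabs y0 + d + 1).
  set (v := d * (d * (d * m))).
  assert (Hv : 0 < v) by (do 3 (apply Rmult_lt_0_compat; [exact Hd|]); exact Hm).
  pose proof PI_RGT_0 as Hpi.
  (* Chosen so that the bound 2 pi * 450 pi / K on the right side equals w v / K, which is below v
     as soon as K > w. *)
  set (w := 2 * PI * (450 * PI) / v).
  assert (Hw : 0 < w) by (apply Rdiv_lt_0_compat; nra).
  (* Besides K > w, this gives e^K >= 1 + a^2 + b^2, so the cutoff is 1 on the rectangle |x| <= a,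
     |y| <= b. *)
  set (K := 1 + a * a + b * b + w).
  assert (HK : 1 <= K) by (unfold K; nra).
  assert (HEK : 1 + a * a + b * b <= exp K).
  { pose proof (exp_ineq1_le K). unfold K in *; lra. }
  assert (Ha : 1 <= a) by (unfold a; pose proof (Rabs_pos x0); lra).
  assert (Hb : 1 <= b) by (unfold b; pose proof (Rabs_pos y0); lra).
  assert (Hone : forall x y, Rabs x <= a -> Rabs y <= b -> cutoff K (x, y) = 1).
  { intros x y Hx Hy. apply cutoff_one; [exact HK|].
    assert (Sq : forall z c, Rabs z <= c -> z * z <= c * c).
    { intros z c Hz. change (z * z) with (Rsqr z). rewrite Rsqr_abs. unfold Rsqr.
      pose proof (Rabs_pos z). nra. }
    apply Sq in Hx. apply Sq in Hy. lra. }
  pose proof (continuous_cutoff K HK) as Hc.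
  assert (HM : 0 <= exp K + 1) by (pose proof (exp_pos K); lra).
  pose proof (ground_state_identity (exp K + 1) (exp K) (cutoff K)
    (Rlt_le _ _ (exp_pos K)) (Rle_refl _) Hc (cutoff_zero K HK)) as Id.
  match type of Id with ?L = ?R => assert (HL : v <= L); [|assert (HR : R <= w * v / K)] end.
  - unfold v. replace d with (t + d - t) at 1 by ring.
    apply RInt_ge_sub; [lra|lra|lra| | |].
    + intros s. apply (continuous_plane_int (exp K + 1) (fun z =>
        (cutoff K (snd z) * F (fst (snd z) + cos (fst z), snd (snd z) + sin (fst z))
         - cutoff K (fst (snd z) + cos (fst z), snd (snd z) + sin (fst z)) * F (snd z))
        * (cutoff K (snd z) * F (fst (snd z) + cos (fst z), snd (snd z) + sin (fst z))
         - cutoff K (fst (snd z) + cos (fst z), snd (snd z) + sin (fst z)) * F (snd z))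
        / (F (snd z) * F (fst (snd z) + cos (fst z), snd (snd z) + sin (fst z))))).
      cont. apply Rgt_not_eq, FF.
    (* Nonnegativity of the plane integral is the box bound for a degenerate box at the origin. *)
    + intros s. replace 0 with (0 * (0 * 0)) by ring.
      apply plane_int_ge_box with 0 0; try lra.
      * cont. apply Rgt_not_eq, FF.
      * intros p. apply Rle_mult_inv_pos; [apply Rle_0_sqr|apply FF].
      * intros x y _ _. apply Rle_mult_inv_pos; [apply Rle_0_sqr|apply FF].
    + intros s Hs.
      assert (Hx0 := Rle_abs x0). assert (Hx0' := Rabs_maj2 x0).
      assert (Hy0 := Rle_abs y0). assert (Hy0' := Rabs_maj2 y0).
      apply plane_int_ge_box with x0 y0; try (unfold a, b in *; nra).
      * cont. apply Rgt_not_eq, FF.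
      * intros p. apply Rle_mult_inv_pos; [apply Rle_0_sqr|apply FF].
      * intros x y Hx Hy. cbv beta; simpl fst; simpl snd.
        rewrite !Hone, !Rmult_1_l; [now apply (Hbox s x y)| | | |];
          apply Rabs_le; pose proof (COS_bound s); pose proof (SIN_bound s);
          unfold a, b; lra.
  - apply Rle_trans with (RInt (fun _ => 450 * PI / K) 0 (2 * PI)).
    + apply RInt_mono; [lra| |cont|].
      * intros s. apply (continuous_plane_int (exp K + 1) (fun z =>
          (cutoff K (snd z) - cutoff K (fst (snd z) + cos (fst z), snd (snd z) + sin (fst z)))
          * (cutoff K (snd z) - cutoff K (fst (snd z) + cos (fst z), snd (snd z) + sin (fst z))))).
        cont.
      * intros s. apply cutoff_energy; [exact HK|].
        pose proof (sin2_cos2 s). unfold Rsqr in *; lra.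
    + rewrite RInt_cst. right. unfold w. field. lra.
  - assert (w * v / K < v); [|lra].
    apply Rlt_div_l; [lra|]. unfold K. nra.
Qed.

(** * From unit steps to arbitrary translations *)

Lemma horizontal_invariant s x y : 0 <= s <= 1 -> F (x + s, y) = F (x, y).
Proof.
  (* The unit steps at angles t and 2 pi - t add up to (2 cos t, 0) = (s, 0). *)
  intros Hs. set (t := acos (s / 2)).
  assert (Hc : cos t = s / 2) by (apply cos_acos; lra).
  assert (Ht : 0 <= t <= PI) by apply acos_bound.
  (* The angle 2 pi - t must stay strictly below 2 pi; t = 0 would force s = 2. *)
  assert (Ht0 : 0 < t).
  { destruct (Req_dec t 0) as [E|E]; [|lra]. rewrite E, cos_0 in Hc. lra. }
  rewrite <- (unit_step_invariant (x, y) t) by lra.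
  rewrite <- (unit_step_invariant (fst (x, y) + cos t, snd (x, y) + sin t) (2 * PI - t)) by lra.
  simpl. rewrite cos_minus, sin_minus, cos_2PI, sin_2PI, Hc.
  f_equal. f_equal; field.
Qed.

Lemma vertical_invariant s x y : 0 <= s <= 1 -> F (x, y + s) = F (x, y).
Proof.
  (* The unit steps at angles t and pi - t add up to (0, 2 sin t) = (0, s). *)
  intros Hs. pose proof PI_RGT_0 as Hpi. set (t := asin (s / 2)).
  assert (Hc : sin t = s / 2) by (apply sin_asin; lra).
  assert (Ht : 0 <= t <= PI / 2).
  { pose proof (asin_bound (s / 2)) as B. fold t in B. split; [|apply B].
    apply Rnot_lt_le. intros L.
    assert (sin t < 0) by (apply sin_lt_0_var; lra). lra. }
  rewrite <- (unit_step_invariant (x, y) t) by lra.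
  rewrite <- (unit_step_invariant (fst (x, y) + cos t, snd (x, y) + sin t) (PI - t)) by lra.
  simpl. rewrite cos_minus, sin_minus, cos_PI, sin_PI, Hc.
  f_equal. f_equal; field.
Qed.

End UnitMean.

Lemma constant_of_small_translations (g : R -> R) :
  (forall s x, 0 <= s <= 1 -> g (x + s) = g x) -> forall x y, g x = g y.
Proof.
  intros H.
  assert (Hn : forall n x s, 0 <= s <= INR n -> g (x + s) = g x).
  { induction n as [|n IH]; intros x s Hs.
    - simpl in Hs. f_equal; lra.
    - rewrite S_INR in Hs. destruct (Rle_lt_dec s 1) as [L|L]; [now apply H|].
      replace (x + s) with (x + (s - 1) + 1) by ring.
      rewrite H, IH; [reflexivity|lra|lra]. }
  assert (Hle : forall x y, x <= y -> g x = g y).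
  { intros x y L. destruct (nfloor_ex (y - x)) as [n Hfl]; [lra|].
    replace y with (x + (y - x)) by ring. symmetry. apply (Hn (S n)).
    rewrite S_INR. lra. }
  intros x y. destruct (Rle_lt_dec x y) as [L|L]; [now apply Hle|].
  symmetry; apply Hle; lra.
Qed.

Theorem mainTheorem4 (f : C -> R)
  (f_cont : forall z : C, continuous f z)
  (f_pos : forall z : C, 0 < f z)
  (f_mean : forall z : C,
    f z = / (2 * PI) * RInt (fun t : R => f (z + expi t)%C) 0 (2 * PI)) :
  exists c : R, forall z : C, f z = c.
Proof.
  assert (Hm : forall p : R * R,
    RInt (fun t => f (fst p + cos t, snd p + sin t)) 0 (2 * PI) = 2 * PI * f p).
  (* Complex addition is coordinatewise by computation, so the integrands are convertible. *)
  { intros p. rewrite (f_mean p). pose proof PI_RGT_0.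
    rewrite <- Rmult_assoc, Rinv_r, Rmult_1_l by lra. reflexivity. }
  exists (f (0, 0)). intros [x y].
  transitivity (f (0, y)).
  - apply (constant_of_small_translations (fun x => f (x, y))). intros s x' Hs.
    now apply horizontal_invariant.
  - apply (constant_of_small_translations (fun y => f (0, y))). intros s y' Hs.
    now apply vertical_invariant.
Qed.
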